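(* Let $\pi\in S_n$ contain exactly $r$ occurrences of the pattern $132$. Then the size of the kernel of $\pi$ is at most $2r+1$.
   Context: Patterns. An occurrence of $132$ in $\pi\in S_n$ is a triple of positions $i<j<k$ with $\pi(i)<\pi(k)<\pi(j)$. The graph $G_\pi$. $G_\pi$ is the bipartite graph with vertex classes $V_1$ and $V_3$. The class $V_1$ is the set of entries of $\pi$, and $V_3$ is the set of occurrences of $132$ in $\pi$. An entry is adjacent to an occurrence exactly when it is one of the three entries of that occurrence. Kernel. The kernel of $\pi$ is the subsequence of $\pi$ formed by the entries lying in the connected component of $G_\pi$ containing the entry $n$. Its size is the number of entries in this subsequence. *)

(* Defs.v *)
(** Permutations of {1, ..., n} are rendered as ['S_n], the
    permutations of ['I_n] = {0, ..., n-1}: positions and entries are both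
    shifted down by one. *)
From mathcomp Require Import all_boot all_order all_fingroup.

Set Implicit Arguments.
Unset Strict Implicit.
Unset Printing Implicit Defensive.

Definition is_occ132 (n : nat) (pi : 'S_n) (t : 'I_n * 'I_n * 'I_n) : bool :=
  let: (i, j, k) := t in
  [&& i < j, j < k, pi i < pi k & pi k < pi j].

Definition occ132 (n : nat) (pi : 'S_n) : finType :=
  {t : 'I_n * 'I_n * 'I_n | is_occ132 pi t}.

Definition occ_entries (n : nat) (pi : 'S_n) (o : occ132 pi) : {set 'I_n} :=
  let: (i, j, k) := val o in [set pi i; pi j; pi k].

(** The vertices of the graph G_pi: [inl] is the class V_1 (entries, i.e.
    values of [pi], not positions) and [inr] is the class V_3. *)
Definition vertex (n : nat) (pi : 'S_n) : finType := ('I_n + occ132 pi)%type.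

Definition adj (n : nat) (pi : 'S_n) : rel (vertex pi) :=
  fun u v =>
    match u, v with
    | inl x, inr o => x \in occ_entries o
    | inr o, inl x => x \in occ_entries o
    | _, _ => false
    end.

Definition word (n : nat) (pi : 'S_n) : seq 'I_n := [seq pi i | i <- enum 'I_n].

(** The kernel refers to the largest entry, so it needs a nonempty permutation;
    [ord_max : 'I_n.+1] is that entry. *)
Definition kernel (n : nat) (pi : 'S_n.+1) : seq 'I_n.+1 :=
  [seq x <- word pi | connect (@adj n.+1 pi) (inl ord_max) (inl x)].

(* Main.v *)
(** The component of [n] is grown from [n] one occurrence at a time: an
    occurrence that meets the entries reached so far brings in at most two new
    ones, and no occurrence is used twice. *)
Require Import Defs.
From mathcomp Require Import all_boot all_order all_fingroup.

(** Read each occurrence as a hyperedge on the entries, with at most three elements.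
    [hyperedge_closure] yields a set [B] containing the largest entry and every hyperedge that meets
    it; each of the [r] hyperedges costs at most two elements, so [B] has at most [1 + 2 * r]. No
    edge of the graph leaves [B], hence the kernel lies inside it. *)

Lemma hyperedge_closure (T O : finType) (e : O -> {set T}) (d : nat) (A : {set T}) :
  (forall o, #|e o| <= d.+1) ->
  exists B : {set T},
    [/\ A \subset B,
        forall o x, x \in e o -> x \in B -> e o \subset B
      & #|B| <= #|A| + d * #|[set o | ~~ (e o \subset A)]|].
Proof.
move=> ed; move: {2}_.+1 (ltnSn #|[set o | ~~ (e o \subset A)]|) => m.
elim: m A => // m IHm A; rewrite ltnS => leUm.
have [/existsP[o /andP[meet out]] | closedA] :=
  boolP [exists o, (e o :&: A != set0) && ~~ (e o \subset A)]; last first.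
  exists A; split=> //; last exact: leq_addr.
  move=> o x xo xA; apply: contraR closedA => out; apply/existsP; exists o.
  by rewrite out andbT; apply/set0Pn; exists x; rewrite inE xo.
(* The induction measure drops: enlarging [A] exposes no new hyperedge, and [o] itself is now
   absorbed. *)
have ltU : #|[set o' | ~~ (e o' \subset A :|: e o)]|
           < #|[set o' | ~~ (e o' \subset A)]|.
  apply/proper_card/properP; split; last by exists o; rewrite !inE ?subsetUr.
  apply/subsetP=> o'; rewrite !inE; apply: contra => sA.
  exact: subset_trans sA (subsetUl _ _).
have [B [sAB closedB leB]] := IHm _ (leq_trans ltU leUm).
exists B; split=> //; first exact: subset_trans (subsetUl _ _) sAB.
(* One of the at most [d.+1] elements of [e o] already lies in [A], so at most [d] are new. *)
have leAo : #|A :|: e o| <= #|A| + d.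
  rewrite cardsU -addnBA ?subset_leq_card ?subsetIr // leq_add2l leq_subLR.
  by rewrite (leq_trans (ed o)) // -add1n leq_add2r card_gt0 setIC.
apply: leq_trans leB _; apply: leq_trans (leq_add leAo (leqnn _)) _.
by rewrite -addnA leq_add2l -mulnS leq_mul2l ltU orbT.
Qed.

Lemma card_occ_entries (n : nat) (pi : 'S_n) (o : occ132 pi) :
  #|occ_entries o| <= 3.
Proof.
rewrite /occ_entries; case: (val o) => [[i j] k].
apply: leq_trans (leq_card_setU _ _) _.
by rewrite cards1 cards2 addn1 ltnS; case: eqP.
Qed.

Theorem theorem1 (n r : nat) (pi : 'S_n.+1) (hr : #|occ132 pi| = r) :
  size (kernel pi) <= 2 * r + 1.
Proof.
have [B [sB closedB leB]] :=
  hyperedge_closure _ _ _ 2 [set ord_max] (@card_occ_entries _ pi).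
have kerB : {subset kernel pi <= B}.
  (* [B] is extended to occurrence vertices by asking that all their entries lie in [B]; closure
     under hyperedges then says that [a] is constant along edges. *)
  pose a := [pred v : vertex pi |
    match v with inl x => x \in B | inr o => occ_entries o \subset B end].
  have clos_a : closed (@adj n.+1 pi) a.
    have xo x (o : occ132 pi) : x \in occ_entries o ->
        (x \in B) = (occ_entries o \subset B).
      by move=> x_o; apply/idP/idP=> [/(closedB _ _ x_o) // | /subsetP->].
    by move=> [x|o] [y|o'] //= h; rewrite !inE /= (xo _ _ h).
  move=> x; rewrite mem_filter => /andP[/(closed_connect clos_a)].
  by rewrite !inE /= => <- _; rewrite -sub1set.
(* Entries of a permutation are distinct, so the length of the kernel is the cardinality of its set
   of entries. *)
have uk : uniq (kernel pi).
  by rewrite filter_uniq // map_inj_uniq ?enum_uniq //; apply: perm_inj.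
rewrite -(card_uniqP uk) -hr addnC.
have /subset_leq_card/leq_trans -> // : kernel pi \subset B by apply/subsetP.
apply: leq_trans leB _.
by rewrite cards1 leq_add2l leq_mul2l max_card.
Qed.
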